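(* Let $\varepsilon\in\{1,-1\}$, $\nu,\beta\in\mathbb{N}_0$, $\alpha\in\mathbb{N}$, and let $U_{k\alpha}(x)$, $V_{(k-1)\alpha}(x)$, $A_{(k-1)\alpha}(N;x)$ $(k\in\mathbb{N})$ be the polynomials defined by the recurrence relations in the context. Then for all $k\in\mathbb{N}$, $$U_{k\alpha}(x)=(\nu+1)\,x^\alpha A_{(k-1)\alpha}(1;x)-\varepsilon A_{(k-1)\alpha}(0;x)-\nu^k x^{k\alpha},$$ $$V_{(k-1)\alpha}(x)=-\varepsilon\,\nu!\,x^\beta A_{(k-1)\alpha}(0;x).$$
   Context: $\mathbb{N}=\{1,2,\dots\}$ and $\mathbb{N}_0=\mathbb{N}\cup\{0\}$. For fixed parameters $\varepsilon,\nu,\alpha,\beta$, the polynomials $U_{k\alpha}(x)$, $V_{(k-1)\alpha}(x)$ in $x$ and $A_{(k-1)\alpha}(N;x)$ in $N$ and $x$ are determined recursively, for $k=1,2,\dots$, by $$\sum_{\ell=1}^{k+1}\binom{k+1}{\ell}x^{(k-\ell+1)\alpha}U_{\ell\alpha}(x)-\varepsilon U_{k\alpha}(x)-x^{(k+1)\alpha}=0,\qquad U_{1\alpha}(x)=x^\alpha-\varepsilon,$$ $$\sum_{\ell=1}^{k+1}\binom{k+1}{\ell}x^{(k-\ell+1)\alpha}V_{(\ell-1)\alpha}(x)-\varepsilon V_{(k-1)\alpha}(x)+\varepsilon\,\nu!\,\nu^k x^{k\alpha+\beta}=0,\qquad V_0(x)=-\varepsilon\,\nu!\,x^\beta,$$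 $$\sum_{\ell=1}^{k+1}\binom{k+1}{\ell}x^{(k-\ell+1)\alpha}A_{(\ell-1)\alpha}(N;x)-\varepsilon A_{(k-1)\alpha}(N;x)-(N+\nu)^k x^{k\alpha}=0,\qquad A_0(N;x)=1.$$ (In each recurrence the $\ell=k+1$ term has coefficient $1$.) $A_{(k-1)\alpha}(1;x)$ and $A_{(k-1)\alpha}(0;x)$ denote the values at $N=1$ and $N=0$. *)

(* Defs.v *)
From HB Require Import structures.
From mathcomp Require Import all_boot all_order all_algebra.

Set Implicit Arguments.
Unset Strict Implicit.
Unset Printing Implicit Defensive.

Import Order.TTheory GRing.Theory Num.Theory.
Local Open Scope ring_scope.

(* The families are indexed by their literal subscripts, so U_{k alpha} is
   [U (k * alpha)%N]; the values of [U], [V], [A] at indices that are not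
   multiples of alpha (and at index 0 for [U]) are irrelevant junk.  The
   exponent (k - l + 1) alpha is written [(k.+1 - l) * alpha] because natural
   subtraction truncates and l ranges up to k + 1. *)

Definition U_recurrence (R : numDomainType) (eps : R) (alpha : nat)
    (U : nat -> {poly R}) : Prop :=
  U (1 * alpha)%N = 'X^alpha - eps%:P /\
  forall k : nat, (1 <= k)%N ->
    \sum_(1 <= l < k.+2)
        'C(k.+1, l)%:R * 'X^((k.+1 - l) * alpha) * U (l * alpha)%N
      - eps%:P * U (k * alpha)%N - 'X^(k.+1 * alpha) = 0.

Definition V_recurrence (R : numDomainType) (eps : R) (nu alpha beta : nat)
    (V : nat -> {poly R}) : Prop :=
  V 0%N = - (eps%:P * nu`!%:R * 'X^beta) /\
  forall k : nat, (1 <= k)%N ->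
    \sum_(1 <= l < k.+2)
        'C(k.+1, l)%:R * 'X^((k.+1 - l) * alpha) * V ((l - 1) * alpha)%N
      - eps%:P * V ((k - 1) * alpha)%N
      + eps%:P * nu`!%:R * nu%:R ^+ k * 'X^(k * alpha + beta) = 0.

(* Polynomials in N and x are encoded in {poly {poly R}}: the outer
   indeterminate 'X is N and the inner one, ('X)%:P, is x.  Hence
   [(A n).[c]] : {poly R} is A_n(c; x). *)
Definition A_recurrence (R : numDomainType) (eps : R) (nu alpha : nat)
    (A : nat -> {poly {poly R}}) : Prop :=
  A 0%N = 1 /\
  forall k : nat, (1 <= k)%N ->
    \sum_(1 <= l < k.+2)
        'C(k.+1, l)%:R * ('X^((k.+1 - l) * alpha))%:P * A ((l - 1) * alpha)%N
      - (eps%:P)%:P * A ((k - 1) * alpha)%N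
      - ('X + nu%:R) ^+ k * ('X^(k * alpha))%:P = 0.

(* Each recurrence has a solution, since its l = k + 1 term has coefficient 1. *)
Lemma binomial_recurrence_exists (S : comNzRingType) (y : nat -> S) (e a : S)
    (g : nat -> S) (y0 : y 0%N = 1) :
  exists f : nat -> S, f 1%N = a /\
    forall k : nat, (1 <= k)%N ->
      \sum_(1 <= l < k.+2) 'C(k.+1, l)%:R * y (k.+1 - l)%N * f l
        - e * f k + g k = 0.
Proof.
pose next k (s : seq S) := e * s`_k - g k
  - \sum_(1 <= l < k.+1) 'C(k.+1, l)%:R * y (k.+1 - l)%N * s`_l.
pose fix tab n : seq S :=
  if n is m.+1 then rcons (tab m) (if m is 0%N then a else next m (tab m))
  else [:: 0].
have size_tab n : size (tab n) = n.+1 by elim: n => //= n IH; rewrite size_rcons IH.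
have nth_tab n l : (l <= n)%N -> (tab n)`_l = (tab l)`_l.
  elim: n => [|n IH]; first by case: l.
  rewrite leq_eqVlt => /predU1P[-> //|ltln].
  by rewrite /= nth_rcons size_tab ltln; apply: IH.
exists (fun k => (tab k)`_k); split; first by [].
case=> // k _; rewrite big_nat_recr //= binn subnn y0 !mul1r.
rewrite [in X in _ + X - _](nth_rcons 0) size_rcons size_tab ltnn eqxx.
rewrite -/(tab k.+1) /next (nth_tab k.+1 k.+1) //.
rewrite (@eq_big_nat _ _ _ _ _ _ (fun l => 'C(k.+2, l)%:R
  * y (k.+2 - l)%N * (tab k.+1)`_l)); last first.
  by move=> l /andP[_ ltl]; rewrite (nth_tab k.+1 l).
rewrite [in LHS](addrC (\big[_/_]_(_ <= _ < _) _)) subrK.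
by rewrite [X in X + _]addrAC subrr add0r addNr.
Qed.

Lemma U_recurrence_exists (R : numDomainType) (eps : R) (alpha : nat)
    (alpha_gt0 : (0 < alpha)%N) :
  exists U, U_recurrence eps alpha U.
Proof.
have [//|f [f1 fS]] := @binomial_recurrence_exists {poly R}
  (fun i => 'X^(i * alpha)) eps%:P ('X^alpha - eps%:P)
  (fun k => - 'X^(k.+1 * alpha)).
exists (fun n => f (n %/ alpha)%N); split=> [|k k_gt0]; first by rewrite mulnK.
rewrite -[RHS](fS k k_gt0) mulnK //; congr (_ - _ - _).
by apply: eq_bigr => l _; rewrite mulnK.
Qed.

Lemma V_recurrence_exists (R : numDomainType) (eps : R) (nu alpha beta : nat)
    (alpha_gt0 : (0 < alpha)%N) :
  exists V, V_recurrence eps nu alpha beta V.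
Proof.
have [//|f [f1 fS]] := @binomial_recurrence_exists {poly R}
  (fun i => 'X^(i * alpha)) eps%:P (- (eps%:P * nu`!%:R * 'X^beta))
  (fun k => eps%:P * nu`!%:R * nu%:R ^+ k * 'X^(k * alpha + beta)).
exists (fun n => f (n %/ alpha).+1); split=> [|k k_gt0]; first by rewrite div0n.
rewrite -[RHS](fS k k_gt0) mulnK // subn1 prednK //; congr (_ - _ + _).
by apply: eq_big_nat => l /andP[l_gt0 _]; rewrite mulnK // subn1 prednK.
Qed.

Lemma A_recurrence_exists (R : numDomainType) (eps : R) (nu alpha : nat)
    (alpha_gt0 : (0 < alpha)%N) :
  exists A, A_recurrence eps nu alpha A.
Proof.
have [//|f [f1 fS]] := @binomial_recurrence_exists {poly {poly R}}
  (fun i => ('X^(i * alpha))%:P) (eps%:P)%:P 1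
  (fun k => - (('X + nu%:R) ^+ k * ('X^(k * alpha))%:P)).
exists (fun n => f (n %/ alpha).+1); split=> [|k k_gt0]; first by rewrite div0n.
rewrite -[RHS](fS k k_gt0) mulnK // subn1 prednK //; congr (_ - _ - _).
by apply: eq_big_nat => l /andP[l_gt0 _]; rewrite mulnK // subn1 prednK.
Qed.

(* Main.v *)
Require Import Defs.
From HB Require Import structures.
From mathcomp Require Import all_boot all_order all_algebra.
From mathcomp Require Import ring.

Set Implicit Arguments.
Unset Strict Implicit.
Unset Printing Implicit Defensive.

Import Order.TTheory GRing.Theory Num.Theory.
Local Open Scope ring_scope.

(** With y = x^alpha, all three recurrences prescribe the value of one and the
    same linear operator [binom_op y eps] on a sequence indexed from 1 (U itself,
    V and A shifted by one), and only the right-hand sides differ: y^(k+1) for U,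
    - eps nu! x^beta (nu y)^k for V and ((N + nu) y)^k for A(N). Such a
    prescription together with the first term determines the sequence, because
    the last coefficient 'C(k+1, k+1) is 1 ([binom_op_inj]). It is therefore
    enough to apply the operator to the claimed formulas. For V this is
    linearity. For U, the operator maps the geometric sequence (nu y)^l to
    (y + nu y)^(k+1) - y^(k+1) - eps (nu y)^k by the binomial theorem
    ([binom_op_geom]); in
      (nu + 1) y A(1) - eps A(0) - (nu y)^k
    the term ((nu + 1) y)^(k+1) cancels against the contribution of A(1), the
    term eps (nu y)^k against that of A(0), and y^(k+1) is left. *)

Section BinomialOperator.

Variables (S : comNzRingType) (y e : S).
Implicit Types (f g : nat -> S) (a : S).

Definition binom_op f k : S :=
  \sum_(1 <= l < k.+2) 'C(k.+1, l)%:R * y ^+ (k.+1 - l) * f l - e * f k.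

Lemma binom_opZ a f k : binom_op (fun l => a * f l) k = a * binom_op f k.
Proof.
rewrite /binom_op mulrBr mulr_sumr; congr (_ - _); last by ring.
by apply: eq_bigr => l _; ring.
Qed.

Lemma binom_opB f g k :
  binom_op (fun l => f l - g l) k = binom_op f k - binom_op g k.
Proof.
rewrite /binom_op (eq_bigr (fun l => 'C(k.+1, l)%:R * y ^+ (k.+1 - l) * f l
  - 'C(k.+1, l)%:R * y ^+ (k.+1 - l) * g l)) => [|l _]; last by ring.
by rewrite sumrB; ring.
Qed.

(** The sum in the operator is the binomial expansion of (y + z)^(k+1) without
    its term of index 0, which accounts for y^(k+1). *)
Lemma binom_op_geom (z : S) k :
  binom_op (fun l => z ^+ l) k = (y + z) ^+ k.+1 - y ^+ k.+1 - e * z ^+ k.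
Proof.
rewrite /binom_op exprDn -(big_mkord xpredT (fun i => y ^+ (k.+1 - i) * z ^+ i
  *+ 'C(k.+1, i))) [in RHS]big_ltn //.
rewrite bin0 subn0 expr0 mulr1 mulr1n [y ^+ k.+1 + _]addrC addrK.
by congr (_ - _); apply: eq_bigr => l _; rewrite -mulrA mulr_natl.
Qed.

(** Since 'C(k.+1, k.+1) = 1, the value of the operator at [k] gives the term of
    index [k.+1] from the terms of index 1 to [k]. *)
Lemma binom_op_inj f g :
    f 1%N = g 1%N ->
    (forall k, (1 <= k)%N -> binom_op f k = binom_op g k) ->
  forall k, (1 <= k)%N -> f k = g k.
Proof.
move=> fg1 fgS; elim/ltn_ind => [[//|[//|k]]] IH _.
have := fgS k.+1 isT.
rewrite /binom_op !(@big_nat_recr _ _ _ k.+2) //= binn subnn expr0 !mul1r.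
rewrite (IH k.+1) // (@eq_big_nat _ _ _ _ _ _
  (fun l => 'C(k.+2, l)%:R * y ^+ (k.+2 - l) * g l)).
  by move=> /addIr /addrI.
by move=> l /andP[l_gt0 l_lt]; rewrite IH.
Qed.

End BinomialOperator.

Section RecurrencesAsOperator.

Variables (R : numDomainType) (eps : R) (nu alpha beta : nat).
Local Notation op := (@binom_op {poly R} 'X^alpha eps%:P).

Lemma expr_mulX (k : nat) : 'X^(k * alpha) = ('X^alpha) ^+ k :> {poly R}.
Proof. by rewrite mulnC exprM. Qed.

Lemma U_recurrence_op (U : nat -> {poly R}) (k : nat) :
    U_recurrence eps alpha U -> (1 <= k)%N ->
  op (fun l => U (l * alpha)%N) k = ('X^alpha) ^+ k.+1.
Proof.
case=> _ US /US /eqP; rewrite subr_eq0 expr_mulX => /eqP <-.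
by congr (_ - _); apply: eq_bigr => l _; rewrite expr_mulX.
Qed.

Lemma V_recurrence_op (V : nat -> {poly R}) (k : nat) :
    V_recurrence eps nu alpha beta V -> (1 <= k)%N ->
  op (fun l => V ((l - 1) * alpha)%N) k
    = - (eps%:P * nu`!%:R * 'X^beta) * (nu%:R * 'X^alpha) ^+ k.
Proof.
case=> _ VS /VS /eqP; rewrite addr_eq0 exprD expr_mulX => /eqP VSk.
transitivity (- (eps%:P * nu`!%:R * nu%:R ^+ k * ('X^alpha ^+ k * 'X^beta))
  : {poly R}); last by rewrite exprMn; ring.
by rewrite -VSk; congr (_ - _); apply: eq_bigr => l _; rewrite expr_mulX.
Qed.

Lemma A_recurrence_op (A : nat -> {poly {poly R}}) (c : {poly R}) (k : nat) :
    A_recurrence eps nu alpha A -> (1 <= k)%N ->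
  op (fun l => (A ((l - 1) * alpha)%N).[c]) k
    = ((c + nu%:R) * 'X^alpha) ^+ k.
Proof.
case=> _ AS /AS /(congr1 (horner_eval c)).
rewrite !rmorphB !rmorphM rmorphXn rmorphD rmorph_sum rmorph0 rmorph_nat /=.
rewrite /horner_eval hornerX !hornerC => /eqP; rewrite subr_eq0 expr_mulX.
rewrite -exprMn => /eqP <-; congr (_ - _); apply: eq_bigr => l _.
by rewrite !hornerM hornerC -expr_mulX -polyC_natr hornerC.
Qed.

End RecurrencesAsOperator.

Theorem theorem3p2 (R : numDomainType) (eps : R) (heps : eps = 1 \/ eps = -1)
    (nu beta alpha : nat) (halpha : (1 <= alpha)%N)
    (U V : nat -> {poly R}) (A : nat -> {poly {poly R}})
    (hU : U_recurrence eps alpha U)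
    (hV : V_recurrence eps nu alpha beta V)
    (hA : A_recurrence eps nu alpha A)
    (k : nat) (hk : (1 <= k)%N) :
  U (k * alpha)%N
    = (nu + 1)%:R * 'X^alpha * (A ((k - 1) * alpha)%N).[1]
      - eps%:P * (A ((k - 1) * alpha)%N).[0]
      - nu%:R ^+ k * 'X^(k * alpha) /\
  V ((k - 1) * alpha)%N
    = - (eps%:P * nu`!%:R * 'X^beta * (A ((k - 1) * alpha)%N).[0]).
Proof.
have A0 c : (A ((1 - 1) * alpha)%N).[c] = 1.
  by case: hA => A0 _; rewrite subnn mul0n A0 hornerC.
split; last first.
  rewrite -mulNr; move: k hk; apply: (@binom_op_inj _ 'X^alpha eps%:P) => [|k hk].
    by case: hV => V0 _; rewrite A0 mulr1 subnn mul0n V0.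
  by rewrite (V_recurrence_op hV) // binom_opZ (A_recurrence_op _ hA) // add0r.
rewrite expr_mulX -exprMn; move: k hk.
apply: (@binom_op_inj _ 'X^alpha eps%:P) => [|k hk].
  by case: hU => -> _; rewrite !A0 natrD expr1; ring.
rewrite (U_recurrence_op hU) // !binom_opB !binom_opZ.
rewrite !(A_recurrence_op _ hA) // binom_op_geom add0r.
have -> : 'X^alpha + nu%:R * 'X^alpha = (1 + nu%:R) * 'X^alpha :> {poly R}.
  by ring.
by rewrite natrD [_ ^+ k.+1 in RHS]exprS; ring.
Qed.
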